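(* For $n\ge 0$, let $f$ be the bijection from $\mathcal{S}_{n,k}$ (the $k$-ary faro words of length $n$) to $\mathcal{B}_{n+2(k-1),k-1}$ (the dispersed Dyck paths of length $n+2(k-1)$ with exactly $k-1$ peaks) defined in the context. For a pattern $p$ let $\mathbf{p}$ denote the statistic counting occurrences of $p$. Then $f$ maps the statistics associated to patterns of length $2$ as follows: for every $w\in\mathcal{S}_{n,k}$, with $P=f(w)$, (1) $\mathbf{11}(w)=\mathbf{FF}(P)$; (2) $\mathbf{21}(w)=\mathbf{UU}(P)=\mathbf{DD}(P)$; (3) $\mathbf{12}(w)=\mathbf{DD(UD)^*UU}(P)+\mathbf{DD(UD)^*D}(P)+\mathbf{DD(UD)^*F}(P)+\mathbf{F(UD)^+F}(P)+\mathbf{F(UD)^*UU}(P)=n-1-\mathbf{UU}(P)-\mathbf{FF}(P)$.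
   Context: Faro words: a $k$-ary word is a word over $\{1,\dots,k\}$. A $k$-ary faro word of length $n$ is a word $u_1v_1u_2v_2u_3v_3\cdots$ of length $n=|u|+|v|$ obtained by interlacing two nondecreasing $k$-ary words $u,v$ with $0\le |u|-|v|\le 1$ (equivalently, $w_i\le w_{i+2}$ for all $1\le i\le n-2$). Blocks: a pair in a faro word $w$ is an occurrence of two consecutive letters $w_iw_{i+1}$ with $w_i>w_{i+1}$; no letter belongs to two pairs. A singleton is a letter $w_i$ (at a position) not belonging to any pair. Paths: a dispersed Dyck path of length $n$ is a lattice path from $(0,0)$ to $(n,0)$ with steps $F=(1,0)$, $U=(1,1)$, $D=(1,-1)$, never going below the $x$-axis, all of whose level steps $F$ lie on the $x$-axis. A peak is an occurrence of $UD$ as two consecutive steps. The map $f$ (depends on $k$): for a $k$-ary faro word $w$ of length $n$, $$f(w)=F^{T_0}U^{T_1}D^{T_2}F^{T_3}U^{T_4}D^{T_5}\cdots F^{T_{3(k-2)}}U^{T_{3(k-2)+1}}D^{T_{3(k-2)+2}}F^{T_{3(k-1)}},$$ where $T_{3(x-1)}$ ($1\le x\le k$) is the number of occurrences of the singleton $x$ in $w$; $T_{3(x-1)-1}$ ($2\le x\le k$) is one plus the number of pairs $xy$ with $y<x$ in $w$; $T_{3(x-1)+1}$ ($1\le x\le k-1$) is one plus the number of pairs $yx$ with $y>x$ in $w$. (For $k=1$, $f(w)=F^{T_0}$.) The map $f$ is a bijection $\mathcal{S}_{n,k}\to\mathcal{B}_{n+2(k-1),k-1}$. Patterns in words are consecutive: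 an occurrence of $11$, $12$, $21$ in $w$ is an index $i$ with $w_i=w_{i+1}$, $w_i<w_{i+1}$, $w_i>w_{i+1}$, respectively. Patterns in paths are factors, i.e. sequences of consecutive steps. For step-words $X,Y,Z$ with $X$ nonempty, $Y$ not ending with $X$ and $Z$ not starting with $X$, an occurrence of $YX^+Z$ (resp. $YX^*Z$) in a path is a factor of the form $YX^jZ$ with $j\ge 1$ (resp. $j\ge 0$), where, for $j\ge 1$, $X^j$ is a maximal run of consecutive repetitions of $X$. E.g. $FUDUDFFUDF$ has two occurrences of $F(UD)^+F$ and three of $F(UD)^*F$.
   Formalization: The last equality of (3), 12(w) = n−1−UU(P)−FF(P), is stated only for n > 0, since at n = 0 it fails (the left side is 0, the right side −1); all other equalities are stated for every n ≥ 0. *)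

(* Defs.v *)
From HB Require Import structures.
From mathcomp Require Import all_boot all_order all_algebra.
From mathcomp Require Import zify.

Set Implicit Arguments.
Unset Strict Implicit.
Unset Printing Implicit Defensive.

(* Word positions are numbered from 0: the i-th letter w_i of the usual
   1-based notation is [nth 0 w i.-1]. *)

Definition kary (k : nat) (w : seq nat) : bool := all (fun x => 1 <= x <= k) w.

Fixpoint interlace (u v : seq nat) : seq nat :=
  match u, v with
  | x :: u', y :: v' => x :: y :: interlace u' v'
  | [::], _ => v
  | _, [::] => u
  end.

Definition is_faro (k : nat) (w : seq nat) : Prop :=
  exists u v : seq nat,
    [/\ kary k u && kary k v, sorted leq u, sorted leq v,
        size v <= size u <= (size v).+1 & w = interlace u v].

(* The set S_{n,k}. *)
Record faro_word (n k : nat) : Type := FaroWord {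
  letters :> seq nat;
  faro_size : size letters = n;
  faro_faro : is_faro k letters }.

(* Occurrences of a consecutive pattern of length 2, given by the relation
   between the two letters. *)
Definition pattern_at (r : rel nat) (w : seq nat) (i : nat) : bool :=
  (i.+1 < size w) && r (nth 0 w i) (nth 0 w i.+1).

Definition pattern_occ (r : rel nat) (w : seq nat) : nat :=
  count (pattern_at r w) (iota 0 (size w)).

Definition occ11 : seq nat -> nat := pattern_occ (fun a b => a == b).
Definition occ12 : seq nat -> nat := pattern_occ (fun a b => a < b).
Definition occ21 : seq nat -> nat := pattern_occ (fun a b => a > b).

Definition pair_at (w : seq nat) (i : nat) : bool :=
  pattern_at (fun a b => a > b) w i.

Definition singleton_at (w : seq nat) (i : nat) : bool :=
  [&& i < size w, ~~ pair_at w i & ~~ ((0 < i) && pair_at w i.-1)].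

Definition num_singleton (w : seq nat) (x : nat) : nat :=
  count (fun i => singleton_at w i && (nth 0 w i == x)) (iota 0 (size w)).

(* The number of pairs xy with y < x. *)
Definition num_pair_top (w : seq nat) (x : nat) : nat :=
  count (fun i => pair_at w i && (nth 0 w i == x)) (iota 0 (size w)).

(* The number of pairs yx with y > x. *)
Definition num_pair_bot (w : seq nat) (x : nat) : nat :=
  count (fun i => pair_at w i && (nth 0 w i.+1 == x)) (iota 0 (size w)).

Inductive step : Type := F | U | D.

Definition step_eqb (s t : step) : bool :=
  match s, t with F, F | U, U | D, D => true | _, _ => false end.

Lemma step_eqP : Equality.axiom step_eqb.
Proof. by move=> [] []; constructor. Qed.

HB.instance Definition _ := hasDecEq.Build step step_eqP.

(* The ordinate of the endpoint of a path starting at height 0. *)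
Definition height (s : seq step) : int :=
  ((count_mem U s)%:Z - (count_mem D s)%:Z)%R.

Definition dispersed_dyck (s : seq step) : Prop :=
  [/\ forall i, i <= size s -> (0 <= height (take i s))%R,
      forall i, i < size s -> nth F s i = F -> height (take i s) = 0%R
    & height s = 0%R].

Definition factor_occ (p s : seq step) : nat :=
  count (fun i => prefix p (drop i s)) (iota 0 (size s).+1).

(* The set B_{n,m}. *)
Record disp_path (n m : nat) : Type := DispPath {
  steps :> seq step;
  disp_size : size steps = n;
  disp_dyck : dispersed_dyck steps;
  disp_peaks : factor_occ [:: U; D] steps = m }.

(* The factor Y X^j Z occurs at position i of s and, if j >= 1, the factor X^j
   is a maximal run of repetitions of X. *)
Definition run_at (Y X Z s : seq step) (i j : nat) : bool :=
  prefix (Y ++ flatten (nseq j X) ++ Z) (drop i s) &&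
  ((0 < j) ==> ~~ suffix X (take (i + size Y) s) &&
               ~~ prefix X (drop (i + size Y + j * size X) s)).

Definition run_occ_from (m : nat) (Y X Z s : seq step) : nat :=
  \sum_(0 <= i < (size s).+1) \sum_(m <= j < (size s).+1) run_at Y X Z s i j.

(* Occurrences of Y X^* Z and Y X^+ Z. *)
Definition star_occ := run_occ_from 0.
Definition plus_occ := run_occ_from 1.

(* Writing f(w) as F^{T_0} U^{T_1} D^{T_2} F^{T_3} ..., this is
   F^{T_{3(x-1)}} U^{T_{3(x-1)+1}} D^{T_{3(x-1)+2}}, whose last exponent
   T_{3(x-1)+2} = T_{3((x+1)-1)-1} is one plus the number of pairs (x+1)y. *)
Definition letter_steps (w : seq nat) (x : nat) : seq step :=
  nseq (num_singleton w x) F ++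
  nseq (num_pair_bot w x).+1 U ++ nseq (num_pair_top w x.+1).+1 D.

Definition faro_steps (k : nat) (w : seq nat) : seq step :=
  flatten [seq letter_steps w x | x <- iota 1 k.-1] ++
  nseq (num_singleton w k) F.

Lemma count_sumn (I : Type) (P : pred I) (g : I -> nat) (s : seq I) (a m : nat) :
  sumn [seq count (fun i => P i && (g i == x)) s | x <- iota a m] =
  count (fun i => P i && (a <= g i < a + m)) s.
Proof.
elim: m a => [|m IH] a /=.
  by rewrite addn0; elim: s => //= i s <-; case: leqP; rewrite ?andbF.
rewrite {}IH; elim: s => //= i s; case: (P i) => //=; lia.
Qed.

Lemma nth_interlace u v i : size v <= size u <= (size v).+1 ->
  nth 0 (interlace u v) i = if odd i then nth 0 v i./2 else nth 0 u i./2.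
Proof.
elim: u v i => [|x u IH] [|y v] i; rewrite /= ?ltnS.
- by move=> _; case: odd; case: i => [|i] /=; rewrite ?nth_nil.
- by [].
- by case: u {IH} => // _; case: i => [|[|i]] //=; rewrite !nth_nil if_same.
by move=> H; case: i => [|[|i]] //=; rewrite negbK IH.
Qed.

Lemma size_interlace u v : size (interlace u v) = size u + size v.
Proof.
elim: u v => [|x u IH] [|y v] //=; first by rewrite addn0.
by rewrite IH; lia.
Qed.

Lemma faro_kary k w : is_faro k w -> kary k w.
Proof.
case=> u [v] [/andP [+ +] _ _ _ ->]; elim: u v => [|x u IH] [|y v] //=.
by move=> /andP [-> Hu] /andP [-> Hv]; apply: IH.
Qed.

Lemma faro_le2 k w : is_faro k w ->
  forall i, i.+2 < size w -> nth 0 w i <= nth 0 w i.+2.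
Proof.
case=> u [v] [_ su sv Huv ->] i; rewrite size_interlace => Hi.
rewrite !nth_interlace //= negbK.
case Ho: (odd i); apply/(sortedP 0) => //; move: Ho; lia.
Qed.

Lemma pair_disjoint k w : is_faro k w ->
  forall i, pair_at w i -> ~~ pair_at w i.+1.
Proof.
move=> /faro_le2 H i /andP [_ h1]; apply/negP => /andP [h2 h3].
by have := H i h2; lia.
Qed.

Lemma count_blocks k w : is_faro k w ->
  count (singleton_at w) (iota 0 (size w)) +
  2 * count (pair_at w) (iota 0 (size w)) = size w.
Proof.
move=> Hw.
pose e i := (0 < i) && pair_at w i.-1.
have He m : count e (iota 0 m.+1) = count (pair_at w) (iota 0 m).
  rewrite /= add0n (iotaDl 1 0) count_map; apply: eq_count => i.
  by rewrite /e /=.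
have Hp : count e (iota 0 (size w)) = count (pair_at w) (iota 0 (size w)).
  case Es: (size w) => [|m] //; rewrite He -addn1 iotaD count_cat /=.
  by rewrite {3}/pair_at /pattern_at Es add0n ltnn /= !addn0.
rewrite mul2n -addnn -{1}Hp -{4}[size w](size_iota 0).
have : {subset iota 0 (size w) <= [pred i | i < size w]}.
  by move=> i; rewrite mem_iota.
elim: (iota 0 (size w)) => //= i s IH Hs.
have {}IH := IH (fun j Hj => Hs j (mem_behead (s := i :: s) Hj)).
have Hi : i < size w by have := Hs i (mem_head _ _).
have -> : singleton_at w i = ~~ pair_at w i && ~~ e i.
  by rewrite /singleton_at Hi.
have : ~~ (e i && pair_at w i).
  case: (i) => //= j; apply/negP => /andP [h1 h2].
  by have := pair_disjoint Hw h1; rewrite h2.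
by move: IH; case: (e i); case: (pair_at w i) => //=; lia.
Qed.

Lemma kary_nth k w i : kary k w -> i < size w -> 1 <= nth 0 w i <= k.
Proof. by move=> /all_nthP; apply. Qed.

Lemma size_faro_steps k w : is_faro k w ->
  size (faro_steps k w) = size w + 2 * (k - 1).
Proof.
move=> Hw; have Hk := faro_kary Hw; case: k Hw Hk => [|k] Hw Hk.
  case: w Hk {Hw} => [|x w] //=.
  by rewrite /kary /=; case: x.
rewrite /faro_steps size_cat size_nseq size_flatten /shape -map_comp /=.
have -> : sumn [seq (size \o letter_steps w) i | i <- iota 1 k] =
  sumn [seq num_singleton w x | x <- iota 1 k] +
  sumn [seq num_pair_bot w x | x <- iota 1 k] +
  sumn [seq num_pair_top w x | x <- iota 2 k] + 2 * k.
  suff H m a : sumn [seq (size \o letter_steps w) i | i <- iota a m] =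
    sumn [seq num_singleton w x | x <- iota a m] +
    sumn [seq num_pair_bot w x | x <- iota a m] +
    sumn [seq num_pair_top w x | x <- iota a.+1 m] + 2 * m by apply: H.
  elim: m a => [|m IH] a; first by rewrite muln0.
  by rewrite /= {}IH /letter_steps !size_cat !size_nseq; lia.
have -> : sumn [seq num_pair_bot w x | x <- iota 1 k] =
          count (pair_at w) (iota 0 (size w)).
  rewrite count_sumn; apply: eq_count => i.
  case Hi: pair_at => //=; move: Hi => /andP [h1 h2].
  by have := kary_nth Hk h1; have := kary_nth Hk (ltnW h1); lia.
have -> : sumn [seq num_pair_top w x | x <- iota 2 k] =
          count (pair_at w) (iota 0 (size w)).
  rewrite count_sumn; apply: eq_count => i.
  case Hi: pair_at => //=; move: Hi => /andP [h1 h2].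
  by have := kary_nth Hk h1; have := kary_nth Hk (ltnW h1); lia.
have : sumn [seq num_singleton w x | x <- iota 1 k] + num_singleton w k.+1 =
       count (singleton_at w) (iota 0 (size w)).
  have -> : sumn [seq num_singleton w x | x <- iota 1 k] + num_singleton w k.+1
    = sumn [seq num_singleton w x | x <- iota 1 k.+1].
    by rewrite -[in RHS](addn1 k) iotaD map_cat sumn_cat /= addn0 add1n.
  rewrite count_sumn; apply: eq_count => i.
  case Hi: singleton_at => //=; move: Hi => /and3P [h1 _ _].
  by have := kary_nth Hk h1; lia.
by have := count_blocks Hw; lia.
Qed.

Lemma factor_occ_cons p a s :
  factor_occ p (a :: s) = prefix p (a :: s) + factor_occ p s.
Proof.
rewrite /factor_occ -[size (a :: s)]/(size s).+1.
rewrite -[iota 0 (size s).+2]/(0 :: iota (1 + 0) (size s).+1) iotaDl.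
have E q (l : seq nat) : count q (0 :: l) = q 0 + count q l by [].
by rewrite E drop0 count_map.
Qed.

Lemma peaks_faro_steps k w : factor_occ [:: U; D] (faro_steps k w) = k - 1.
Proof.
have hF a s : factor_occ [:: U; D] (nseq a F ++ s) = factor_occ [:: U; D] s.
  by elim: a => //= a IH; rewrite factor_occ_cons IH.
have hD a s : factor_occ [:: U; D] (nseq a D ++ s) = factor_occ [:: U; D] s.
  by elim: a => //= a IH; rewrite factor_occ_cons IH.
have hU a b s : factor_occ [:: U; D] (nseq a.+1 U ++ nseq b.+1 D ++ s) =
                (factor_occ [:: U; D] s).+1.
  elim: a => [|a IH].
    by rewrite factor_occ_cons hD /= prefix0s.
  by rewrite factor_occ_cons IH.
rewrite subn1 /faro_steps; elim: k.-1 {1}1 => [|m IH] a /=.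
  by rewrite -[nseq _ _]cats0 hF.
by rewrite /letter_steps -!catA hF hU IH.
Qed.

Fixpoint ok (h : nat) (s : seq step) : bool :=
  match s with
  | [::] => h == 0
  | F :: s' => (h == 0) && ok h s'
  | U :: s' => ok h.+1 s'
  | D :: s' => (0 < h) && ok h.-1 s'
  end.

Lemma height_cons a s : height (a :: s) =
  (height s + match a with F => 0 | U => 1 | D => -1 end)%R.
Proof.
have E b : (count_mem b (a :: s) = (a == b) + count_mem b s)%N by [].
rewrite /height !E; clear E.
have EU : (a == U) = (if a is U then true else false) by case: (a).
have ED : (a == D) = (if a is D then true else false) by case: (a).
by rewrite EU ED; case: a {EU ED} => /=; lia.
Qed.

Lemma ok_spec h s : ok h s ->
  [/\ forall i, i <= size s -> (0 <= h%:Z + height (take i s))%R,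
      forall i, i < size s -> nth F s i = F -> (h%:Z + height (take i s) = 0)%R
    & (h%:Z + height s = 0)%R].
Proof.
have h0 : height [::] = 0%R by [].
elim: s h => [|a s IH] h; first by move=> /= /eqP ->; split; rewrite ?h0.
move=> Ha; have [b /IH [h1 h2 h3] Eb] : exists2 b, ok b s &
    (h%:Z + match a with F => 0 | U => 1 | D => -1 end = b%:Z)%R.
  case: a Ha => /=; first by move=> /andP [/eqP -> Hs]; exists 0.
    by exists h.+1 => //; lia.
  by move=> /andP [Hh Hs]; exists h.-1 => //; lia.
split; last by rewrite height_cons; move: h3 Eb; lia.
  case=> [|i] /=; first by rewrite h0.
  by move=> /h1; rewrite height_cons; move: Eb; lia.
case=> [|i] /=; last by move=> /h2 + Hn => /(_ Hn); rewrite height_cons; move: Eb; lia.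
by move=> _ E; move: Ha; rewrite E h0 /= => /andP [/eqP ->].
Qed.

(* The number of pairs zy with y < x < z. *)
Definition straddle w x :=
  count (fun i => pair_at w i && (nth 0 w i.+1 < x < nth 0 w i)) (iota 0 (size w)).

Lemma straddle_step w x :
  straddle w x + num_pair_bot w x = straddle w x.+1 + num_pair_top w x.+1.
Proof.
rewrite /straddle /num_pair_bot /num_pair_top.
elim: (iota _ _) => //= i s.
by case: (boolP (pair_at w i)) => //= /andP [_ /=]; lia.
Qed.

Lemma nth_le_even w : (forall i, i.+2 < size w -> nth 0 w i <= nth 0 w i.+2) ->
  forall m i, i + m.*2 < size w -> nth 0 w i <= nth 0 w (i + m.*2).
Proof.
move=> H; elim=> [|m IH] i Hi; first by rewrite addn0.
have h : i + m.*2 < size w by lia.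
apply: leq_trans (IH i h) _.
by rewrite doubleS !addnS; apply: H; move: Hi; lia.
Qed.

Lemma straddle_singleton k w x : is_faro k w ->
  0 < num_singleton w x -> straddle w x = 0.
Proof.
move=> Hw; rewrite -has_count => /hasP [p _ /andP [/and3P [Hp Hp1 Hp2] /eqP Hx]].
have Hev := nth_le_even (faro_le2 Hw).
apply/eqP; rewrite -leqn0 leqNgt -has_count; apply/hasP => - [q _].
move=> /andP [/andP [Hq _] /andP [H1 H2]].
case: (ltngtP p q) => Hpq; last by subst q; move: H2; rewrite Hx ltnn.
- case Ho: (odd (q - p)).
    have E : q.+1 = p + ((q - p).+1)./2.*2 by lia.
    by have := Hev ((q - p).+1)./2 p; rewrite -E; lia.
  have E : q.+1 = p.+1 + ((q - p))./2.*2 by lia.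
  have := Hev (q - p)./2 p.+1; rewrite -E => /(_ Hq) h.
  move: Hp1; rewrite /pair_at /pattern_at; lia.
case Ho: (odd (p - q)).
  case: p Hp Hp1 Hp2 Hx Hpq Ho => // p Hp Hp1 /= Hp2 Hx Hpq Ho.
  have E : p = q + ((p - q))./2.*2 by lia.
  have := Hev (p - q)./2 q; rewrite -E => /(_ (ltnW Hp)) h.
  move: Hp2; rewrite /pair_at /pattern_at; lia.
have E : p = q + ((p - q))./2.*2 by lia.
by have := Hev (p - q)./2 q; rewrite -E; lia.
Qed.

Lemma ok_faro_steps k w : is_faro k w -> ok 0 (faro_steps k w).
Proof.
move=> Hw; have Hk := faro_kary Hw.
have okF h a s : ok h (nseq a F ++ s) = ((0 < a) ==> (h == 0)) && ok h s.
  elim: a => //= a ->; case: (h == 0) => //; by rewrite implybT.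
have okU h a s : ok h (nseq a U ++ s) = ok (h + a) s.
  by elim: a h => [|a IH] h /=; rewrite ?addn0 // IH addSnnS.
have okD h a s : ok h (nseq a D ++ s) = (a <= h) && ok (h - a) s.
  elim: a h => [|a IH] h /=; first by rewrite subn0.
  by rewrite IH; case: h => //= h; rewrite subSS.
case: k Hw Hk => [|k] Hw Hk.
  by case: w Hk {Hw} => [|x w] //; rewrite /kary /=; case: x.
have s1 : straddle w 1 = 0.
  apply: etrans (count_pred0 (iota 0 (size w))); apply: eq_count => i.
  rewrite /=; case Hi: pair_at => //=; move: Hi => /andP [h1 h2].
  by have := kary_nth Hk h1; lia.
have sk : straddle w k.+1 = 0.
  apply: etrans (count_pred0 (iota 0 (size w))); apply: eq_count => i.
  rewrite /=; case Hi: pair_at => //=; move: Hi => /andP [h1 h2].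
  by have := kary_nth Hk (ltnW h1); lia.
rewrite /faro_steps /=.
suff H m a : straddle w (a + m) = 0 ->
    ok (straddle w a)
      (flatten [seq letter_steps w x | x <- iota a m] ++ nseq (num_singleton w (a + m)) F).
  by have := H k 1 sk; rewrite s1.
elim: m a => [|m IH] a Ha /=.
  by rewrite -[nseq _ _]cats0 okF /=; move: Ha; rewrite addn0 => ->; rewrite implybT.
rewrite -catA [letter_steps w a]/letter_steps -!catA okF okU okD.
have Hs := straddle_step w a.
have -> : straddle w a + (num_pair_bot w a).+1 - (num_pair_top w a.+1).+1
          = straddle w a.+1 by lia.
have Ea : a + m.+1 = a.+1 + m by rewrite addnS.
rewrite Ea in Ha *; rewrite IH // andbT; apply/andP; split; last by lia.
by apply/implyP => /(straddle_singleton Hw) ->.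
Qed.

Lemma dyck_faro_steps k w : is_faro k w -> dispersed_dyck (faro_steps k w).
Proof.
move=> /ok_faro_steps /ok_spec [h1 h2 h3]; split=> [i /h1|i Hi Hn|].
- by rewrite GRing.add0r.
- by have := h2 i Hi Hn; rewrite GRing.add0r.
by move: h3; rewrite GRing.add0r.
Qed.

Lemma size_faro_word n k (w : faro_word n k) :
  size (faro_steps k w) = n + 2 * (k - 1).
Proof. by rewrite (size_faro_steps (faro_faro w)) faro_size. Qed.

Definition faro_map (n k : nat) (w : faro_word n k) :
    disp_path (n + 2 * (k - 1)) (k - 1) :=
  DispPath (size_faro_word w) (dyck_faro_steps (faro_faro w))
           (peaks_faro_steps k w).

(* Main.v *)
Require Import Defs.
From mathcomp Require Import all_boot all_order all_algebra.
From mathcomp Require Import zify.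

Set Implicit Arguments.
Unset Strict Implicit.
Unset Printing Implicit Defensive.

(** Everything follows from 11 = FF and 21 = UU, since these two numbers and
    [n] determine all the others, on the word as on the path.

    On the word, two consecutive letters are equal, increasing or decreasing,
    so the three statistics add up to [n - 1] (for [n > 0]).  The faro
    condition makes equal neighbours singletons, and makes the singletons with
    a given value occupy consecutive positions; hence a value with [t > 0]
    singletons contributes [t - 1] occurrences of 11, as the run [F^t] does
    for FF ([occ11_singletons]).  A run [U^T] has [T - 1] factors UU, and
    [T - 1] is by definition a number of pairs; summing, UU counts all the
    pairs ([UU_faro_steps]).

    On a dispersed Dyck path, steps up and down are equally numerous.  A U that
    does not start a UU starts a peak, and a D that does not end a DD ends a
    peak; so UU = DD, and as there are [k - 1] peaks, [n = #F + 2 UU]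
    ([dyck_UU_DD], [dyck_size]).  For the run patterns, read
    the path from an occurrence of DD or of F: after the longest possible
    [(UD)^*] there comes UU, D, F or the end of the path, and D cannot come
    after [F (UD)^*], where the height is 0.  So every DD and every F starts
    exactly one of the run patterns (with [F (UD)^* F] including FF), except
    the last of them, which is followed by [(UD)^*] up to the end of the path;
    such a last one exists exactly when [n > 0] ([run_patterns],
    [final_count_pos]).  For [n > 0] the run patterns therefore number
    [DD + #F - FF - 1 = n - 1 - UU - FF], which is also the value of 12; for
    [n = 0] there are none. *)

(** * Counting suffixes *)

(** All the path statistics count the suffixes with some property, which makes
    them amenable to induction on the path. *)
Definition suffix_count (A : pred (seq step)) (s : seq step) : nat :=
  count (fun i => A (drop i s)) (iota 0 (size s).+1).

Lemma suffix_count_cons A a s :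
  suffix_count A (a :: s) = A (a :: s) + suffix_count A s.
Proof.
rewrite /suffix_count -[size (a :: s)]/(size s).+1.
rewrite -[iota 0 (size s).+2]/(0 :: iota (1 + 0) (size s).+1) iotaDl.
have E q (l : seq nat) : count q (0 :: l) = q 0 + count q l by [].
by rewrite E drop0 count_map.
Qed.

Lemma suffix_count_nil A : suffix_count A [::] = A [::].
Proof. by rewrite /suffix_count /= addn0. Qed.

Lemma prefix_cat_drop (p q s : seq step) :
  prefix (p ++ q) s = prefix p s && prefix q (drop (size p) s).
Proof.
elim: p s => [|a p IH] [|b s]; rewrite ?drop0 ?prefix0s //=.
by rewrite IH andbA.
Qed.

(** * Run patterns as suffix statistics *)

Fixpoint strip_UD (s : seq step) : seq step :=
  match s with U :: D :: s' => strip_UD s' | _ => s end.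

Lemma strip_UDF (s : seq step) : ~~ prefix [:: U; D] s -> strip_UD s = s.
Proof. by case: s => [|[] [|[] s]] //=; rewrite prefix0s. Qed.

(** Stripping the whole run detects [Y (UD)^* Z] at the start of [t] only if
    [Z] does not itself start with [UD]. *)
Definition run_suffix (Y Z t : seq step) : bool :=
  prefix Y t && prefix Z (strip_UD (drop (size Y) t)).

(** At most one exponent [j] can work, namely the number of copies of [UD]
    that are stripped. *)
Lemma sum_prefix_strip_UD Z t N :
  (forall r, prefix Z r -> ~~ prefix [:: U; D] r) -> size t < N ->
  \sum_(0 <= j < N) prefix (flatten (nseq j [:: U; D]) ++ Z) t
  = prefix Z (strip_UD t).
Proof.
move=> hZ; elim: N t => // N IH t ht.
rewrite big_nat_recl //=.
case Ht: (prefix [:: U; D] t); last first.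
  rewrite strip_UDF ?Ht // big1 ?addn0 // => j _.
  by rewrite -[U :: _]/([:: U; D] ++ (_ ++ _)) prefix_cat_drop Ht.
have -> : prefix Z t = false by apply: contraTF Ht => /hZ.
case: t ht Ht => [|[] [|[] t]] //= ht _.
by rewrite add0n IH //; apply: ltnW.
Qed.

(** Maximality of the run is automatic when neither [Y] nor [Z] can extend
    it. *)
Lemma star_occ_suffix_count Y Z s :
  (forall r, ~~ suffix [:: U; D] (r ++ Y)) ->
  (forall r, prefix Z r -> ~~ prefix [:: U; D] r) ->
  star_occ Y [:: U; D] Z s = suffix_count (run_suffix Y Z) s.
Proof.
move=> hY hZ; rewrite /star_occ /run_occ_from /suffix_count -sum1_count.
rewrite [RHS]big_mkcond /= /index_iota subn0; apply: eq_bigr => i _.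
rewrite /run_suffix drop_drop [size Y + i]addnC.
case HY: (prefix Y (drop i s)); last first.
  by apply: big1 => j _; rewrite /run_at prefix_cat_drop HY.
transitivity (nat_of_bool (prefix Z (strip_UD (drop (i + size Y) s))));
  last by case: prefix.
rewrite -(@sum_prefix_strip_UD _ _ (size s).+1 hZ); last first.
  by rewrite size_drop ltnS leq_subr.
rewrite /index_iota subn0; apply: eq_bigr => j _.
rewrite /run_at prefix_cat_drop HY drop_drop [size Y + i]addnC /=.
case Hj: prefix => //=; case: j Hj => // j Hj.
rewrite implyTb.
have -> : take (i + size Y) s = take i s ++ Y.
  by move: HY; rewrite takeD prefixE => /eqP ->.
rewrite hY hZ //.
move: Hj; rewrite prefix_cat_drop drop_drop => /andP [_].
by rewrite size_flatten /shape map_nseq sumn_nseq mulnC addnC.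
Qed.

Lemma star_occ_plus Y X Z s :
  star_occ Y X Z s = factor_occ (Y ++ Z) s + plus_occ Y X Z s.
Proof.
rewrite /star_occ /plus_occ /run_occ_from /factor_occ -sum1_count.
rewrite [X in X + _]big_mkcond /= /index_iota !subn0 -big_split /=.
apply: eq_bigr => i _; rewrite big_cons subSS subn0; congr (_ + _).
by rewrite /run_at /= andbT; case: prefix.
Qed.

(** * Dispersed Dyck paths *)

Lemma ok_strip_UD h s : ok h s -> ok h (strip_UD s).
Proof.
have [m] := ubnP (size s); elim: m s => // m IH [|[] [|[] s]] //= hs.
by apply: IH; lia.
Qed.

(** A step up is never followed by a level step or the end of the path. *)
Lemma count_U h s : ok h s ->
  count_mem U s = factor_occ [:: U; U] s + factor_occ [:: U; D] s.
Proof.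
elim: s h => // a s IH h; rewrite !factor_occ_cons.
case: a => /= [/andP [_ /IH ->]|Hs|/andP [_ /IH ->]] //.
rewrite (IH _ Hs).
by case: s Hs {IH} => [|[] s] //= _; rewrite prefix0s; lia.
Qed.

(** A step down is preceded by a step up or down, or starts the path. *)
Lemma count_D h s : ok h s ->
  count_mem D s = factor_occ [:: D; D] s + factor_occ [:: U; D] s
                  + prefix [:: D] s.
Proof.
elim: s h => // a s IH h; rewrite !factor_occ_cons.
case: a => /= [/andP [/eqP-> Hs]|Hs|/andP [_ Hs]]; rewrite (IH _ Hs).
- by case: s Hs {IH} => [|[] s].
- by case: s Hs {IH} => [|[] s] //= _; rewrite ?prefix0s; lia.
by case: s Hs {IH} => [|[] s] //= _; rewrite ?prefix0s; lia.
Qed.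

Lemma ok_height h s : ok h s -> h + count_mem U s = count_mem D s.
Proof.
elim: s h => [|[] s IH] h /=; first by move/eqP->.
- by move=> /andP [_ /IH].
- by move=> /IH <-; rewrite addnA addn1.
by case: h => // h /IH <-.
Qed.

Lemma dyck_UU_DD s : ok 0 s ->
  factor_occ [:: U; U] s = factor_occ [:: D; D] s.
Proof.
move=> Hs; have := ok_height Hs; rewrite (count_U Hs) (count_D Hs).
by case: s Hs => [|[] s] //= _; lia.
Qed.

Lemma dyck_size s : ok 0 s ->
  size s = count_mem F s + (factor_occ [:: U; U] s).*2
           + (factor_occ [:: U; D] s).*2.
Proof.
move=> Hs; have : size s = count_mem F s + count_mem U s + count_mem D s.
  by elim: s {Hs} => //= -[] s -> /=; lia.
by have := ok_height Hs; rewrite (count_U Hs); lia.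
Qed.

(** * Run patterns in dispersed Dyck paths *)

Definition final_suffix (Y t : seq step) : bool :=
  prefix Y t && nilp (strip_UD (drop (size Y) t)).

Definition final_count (s : seq step) : nat :=
  suffix_count (final_suffix [:: D; D]) s + suffix_count (final_suffix [:: F]) s.

(** The suffix of a path after a stripped [(UD)^*] is empty or starts with
    UU, D or F, whence each DD and each F is counted exactly once. *)
Lemma run_suffixes h s : ok h s ->
  suffix_count (run_suffix [:: D; D] [:: U; U]) s
  + suffix_count (run_suffix [:: D; D] [:: D]) s
  + suffix_count (run_suffix [:: D; D] [:: F]) s
  + suffix_count (run_suffix [:: F] [:: F]) s
  + suffix_count (run_suffix [:: F] [:: U; U]) s
  + final_count s = factor_occ [:: D; D] s + count_mem F s.
Proof.
have next h' r : ok h' r ->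
    [/\ prefix [:: U; U] (strip_UD r) + prefix [:: D] (strip_UD r)
        + prefix [:: F] (strip_UD r) + nilp (strip_UD r) = 1
      & h' = 0 -> prefix [:: D] (strip_UD r) = false].
  move=> /ok_strip_UD.
  have : ~~ prefix [:: U; D] (strip_UD r).
    have [m] := ubnP (size r); elim: m r => // m IH [|[] [|[] r]] //= hr.
    by apply: IH; lia.
  case: (strip_UD r) => [|[] [|[] t]] //=; rewrite ?prefix0s ?andbF //;
    by split=> // h0; subst h'.
elim: s h => [|a s IH] h; first by rewrite /final_count !suffix_count_nil.
move=> Hs; have [h' Hs' H0] : exists2 h', ok h' s & a = F -> h' = 0.
  case: a Hs => /=; first by case/andP => /eqP -> ?; exists 0.
    by move=> ?; exists h.+1.
  by case/andP => _ ?; exists h.-1.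
have {IH} := IH _ Hs'; rewrite /final_count !suffix_count_cons !factor_occ_cons.
rewrite /run_suffix /final_suffix /=.
case: a Hs H0 => //= Hs H0; rewrite ?prefix0s ?drop0.
- have [e /(_ (H0 erefl)) e0] := next _ _ Hs'; rewrite e0 in e.
  by move: e {e0}; case: s Hs' Hs => [|b t] Hs' Hs /=; lia.
case: s Hs' Hs => [|[] t] //= Hs' Hs; rewrite ?drop0 ?prefix0s /=; try lia.
by have [_ /next [e _]] := andP Hs'; lia.
Qed.

(** Only the last occurrence of DD or F is followed by [(UD)^*] up to the end.
    The induction goes through a third description of the same event: a path
    that starts at any height avoids both F and DD exactly when it is [(UD)^*]
    or [D (UD)^*]. *)
Lemma final_count_pos h s : ok h s ->
  final_count s = (0 < factor_occ [:: D; D] s + count_mem F s).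
Proof.
pose b r := ~~ nilp (strip_UD r)
            && ~~ (if r is D :: t then nilp (strip_UD t) else false).
suff H : ok h s -> final_count s = b s /\
    (0 < factor_occ [:: D; D] s + count_mem F s) = b s.
  by move=> /H [-> ->].
elim: s h => [|a s IH] h; first by rewrite /final_count !suffix_count_nil.
move=> Hs; have [h' Hs' H0] : exists2 h', ok h' s &
    match a with F => h' = 0 | U => h' = h.+1 | D => true end.
  case: a Hs => /=; first by case/andP => /eqP -> ?; exists 0.
    by move=> ?; exists h.+1.
  by case/andP => _ ?; exists h.-1.
have {IH} := IH _ Hs'; rewrite /final_count !suffix_count_cons !factor_occ_cons.
rewrite /final_suffix /b /=.
case: a Hs H0 => //= Hs H0; rewrite ?prefix0s ?drop0.
- subst h'; case: s Hs' Hs => [|[] t] //= Hs' Hs [] /=.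
  + by move=> e1 e2; split; lia.
  + by case: nilp => /=; lia.
- subst h'; case: s Hs' Hs => [|[] t] //= Hs' Hs [] /=.
  + case E: (nilp _) => /=; last by lia.
    by have := @ok_strip_UD h.+1 (U :: t) Hs'; rewrite /= (nilP E).
  by case: nilp => /=; lia.
by case: s Hs' Hs => [|[] t] //= Hs' Hs; rewrite ?drop0 ?prefix0s /= => -[]; lia.
Qed.

(** The factors FF are the occurrences of [F (UD)^* F] with exponent 0, and the
    last summand stands for the final DD or F, which starts no pattern. *)
Lemma run_patterns s : ok 0 s ->
  star_occ [:: D; D] [:: U; D] [:: U; U] s
  + star_occ [:: D; D] [:: U; D] [:: D] s
  + star_occ [:: D; D] [:: U; D] [:: F] s
  + plus_occ [:: F] [:: U; D] [:: F] s
  + star_occ [:: F] [:: U; D] [:: U; U] s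
  + factor_occ [:: F; F] s
  + (0 < factor_occ [:: D; D] s + count_mem F s)
  = factor_occ [:: D; D] s + count_mem F s.
Proof.
move=> Hs; have := run_suffixes Hs; rewrite (final_count_pos Hs).
have hD r : ~~ suffix [:: U; D] (r ++ [:: D; D]) by rewrite /suffix rev_cat.
have hF r : ~~ suffix [:: U; D] (r ++ [:: F]) by rewrite /suffix rev_cat.
have zU r : prefix [:: U; U] r -> ~~ prefix [:: U; D] r.
  by case: r => [|[] [|[] r]].
have zD r : prefix [:: D] r -> ~~ prefix [:: U; D] r by case: r => [|[] r].
have zF r : prefix [:: F] r -> ~~ prefix [:: U; D] r by case: r => [|[] r].
have := star_occ_plus [:: F] [:: U; D] [:: F] s.
rewrite !star_occ_suffix_count //=; lia.
Qed.

(** * Image of a faro word *)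

Lemma UU_faro_steps k w : is_faro k.+1 w ->
  factor_occ [:: U; U] (faro_steps k.+1 w) = occ21 w.
Proof.
move=> Hw; have Hk := faro_kary Hw.
have hF a s : factor_occ [:: U; U] (nseq a F ++ s) = factor_occ [:: U; U] s.
  by elim: a => //= a IH; rewrite factor_occ_cons IH.
have hD a s : factor_occ [:: U; U] (nseq a D ++ s) = factor_occ [:: U; U] s.
  by elim: a => //= a IH; rewrite factor_occ_cons IH.
have hU a s : factor_occ [:: U; U] (nseq a.+1 U ++ D :: s) =
    a + factor_occ [:: U; U] s.
  elim: a => [|a IH]; first by rewrite !factor_occ_cons.
  by rewrite factor_occ_cons IH /= prefix0s.
have -> : occ21 w = sumn [seq num_pair_bot w x | x <- iota 1 k].
  rewrite count_sumn; apply: eq_count => i.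
  rewrite -/(pair_at w i); case Hi: pair_at => //=; move: Hi => /andP [h1 h2].
  by have := kary_nth Hk h1; have := kary_nth Hk (ltnW h1); lia.
rewrite /faro_steps /=; move: (num_singleton w k.+1) => c.
elim: k 1 {Hw Hk} => [|m IH] a /=.
  by rewrite -[nseq _ _]cats0 hF.
by rewrite /letter_steps -!catA hF hU hD IH.
Qed.

Lemma FF_faro_steps k w :
  factor_occ [:: F; F] (faro_steps k.+1 w) =
  sumn [seq (num_singleton w x).-1 | x <- iota 1 k.+1].
Proof.
have hD b a s : b != F ->
    factor_occ [:: F; F] (nseq a b ++ s) = factor_occ [:: F; F] s.
  by move=> hb; elim: a => //= a IH; rewrite factor_occ_cons IH; case: b hb {IH}.
have hF a s : ~~ prefix [:: F] s ->
    factor_occ [:: F; F] (nseq a F ++ s) = a.-1 + factor_occ [:: F; F] s.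
  move=> hs; elim: a => [|[|a] IH] //=; rewrite factor_occ_cons.
    by move: hs {IH}; case: s => [|[] s] //=; rewrite prefix0s.
  by rewrite IH /= prefix0s.
suff H m a : factor_occ [:: F; F]
      (flatten [seq letter_steps w x | x <- iota a m] ++
       nseq (num_singleton w (a + m)) F) =
    sumn [seq (num_singleton w x).-1 | x <- iota a m.+1] by exact: (H k 1).
elim: m a => [|m IH] a /=.
  by rewrite -[nseq _ _]cats0 hF // addn0.
by rewrite /letter_steps -!catA hF // !hD // -addSnnS IH.
Qed.

(** A set of consecutive integers has one more element than it has pairs of
    neighbours. *)
Lemma count_convex (P : pred nat) n :
  (forall i j m, i <= m <= j -> P i -> P j -> P m) ->
  count (fun i => P i && P i.+1) (iota 0 n) = (count P (iota 0 n.+1)).-1.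
Proof.
move=> H.
have cS Q m : count Q (iota 0 m.+1) = count Q (iota 0 m) + Q m.
  by rewrite -addn1 iotaD count_cat /= addn0.
elim: n => [|n IH]; first by rewrite /= addn0; case: (P 0).
rewrite cS IH [in RHS]cS.
case HP: (P n.+1); rewrite ?andbF ?andbT ?addn0 //.
case: (posnP (count P (iota 0 n.+1))) => [E|].
  by rewrite E; move: E; rewrite cS; case: (P n) => //; lia.
move=> Hc; have [i] : exists2 i, i <= n & P i.
  move: Hc; rewrite -has_count => /hasP [i]; rewrite mem_iota add0n ltnS.
  by exists i.
move=> Hi Pi; rewrite (H i n.+1 n) ?Hi //; lia.
Qed.

(** Letters two places apart are weakly increasing, and a singleton is at
    least its left neighbour and at most its right one; so equal singletons
    squeeze all the letters between them. *)
Lemma singletons_convex k w x i j m : is_faro k w -> i <= m <= j ->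
  singleton_at w i && (nth 0 w i == x) -> singleton_at w j && (nth 0 w j == x) ->
  singleton_at w m && (nth 0 w m == x).
Proof.
move=> Hw /andP [Him Hmj] /andP [/and3P [si i1 i2] /eqP xi].
move=> /andP [/and3P [sj j1 j2] /eqP xj].
have Hev := nth_le_even (faro_le2 Hw).
have ev p q : p <= q -> ~~ odd (q - p) -> q < size w -> nth 0 w p <= nth 0 w q.
  move=> Hpq Ho Hq; have E : q = p + (q - p)./2.*2 by lia.
  by have := Hev (q - p)./2 p; rewrite -E; apply.
have right p : i <= p <= j -> nth 0 w i <= nth 0 w p.
  move=> /andP [h1 h2]; have Hp : p < size w by lia.
  case Ho: (odd (p - i)); last by apply: ev; rewrite // Ho.
  have Hi : i.+1 < size w by move: Ho; lia.
  have : nth 0 w i <= nth 0 w i.+1.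
    by move: i1; rewrite /pair_at /pattern_at Hi /= -leqNgt.
  by move=> h; apply: (leq_trans h); apply: ev => //; move: Ho; lia.
have left p : i <= p <= j -> nth 0 w p <= nth 0 w j.
  move=> /andP [h1 h2]; have Hp : p < size w by lia.
  case Ho: (odd (j - p)); last by apply: ev; rewrite // Ho.
  have Hj : 0 < j by move: Ho; lia.
  have : nth 0 w j.-1 <= nth 0 w j.
    by move: j2; rewrite /pair_at /pattern_at Hj /= prednK // sj /= -leqNgt.
  by apply: leq_trans; apply: ev; move: Ho; lia.
have eqx p : i <= p <= j -> nth 0 w p = x.
  by move=> hp; have := right p hp; have := left p hp; lia.
have mx : nth 0 w m = x by apply: eqx; lia.
rewrite mx eqxx andbT /singleton_at.
have -> /= : m < size w by lia.
apply/andP; split.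
  have [h|h] := ltnP m j; last by have -> : m = j by lia.
  by rewrite /pair_at /pattern_at mx (eqx m.+1) ?ltnn ?andbF //; lia.
have [h|h] := ltnP i m; last by have -> : m = i by lia.
have h0 : 0 < m by lia.
by rewrite h0 /pair_at /pattern_at prednK // mx (eqx m.-1) ?ltnn ?andbF //; lia.
Qed.

(** Two equal neighbours are singletons, because a pair next to them would
    make a letter greater than the one two places later.  Grouped by value,
    they are pairs of neighbours in intervals of positions. *)
Lemma occ11_singletons k w : is_faro k w ->
  occ11 w = sumn [seq (num_singleton w x).-1 | x <- iota 1 k].
Proof.
move=> Hw; have Hk := faro_kary Hw.
pose S x i := singleton_at w i && (nth 0 w i == x).
pose Q i := [&& singleton_at w i, singleton_at w i.+1
              & nth 0 w i == nth 0 w i.+1].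
have -> : [seq (num_singleton w x).-1 | x <- iota 1 k] =
    [seq count (fun i => Q i && (nth 0 w i == x)) (iota 0 (size w))
       | x <- iota 1 k].
  apply: eq_map => x.
  have -> : num_singleton w x = count (S x) (iota 0 (size w).+1).
    rewrite -addn1 iotaD count_cat /= /S /singleton_at ltnn /= !addn0.
    by [].
  rewrite -count_convex => [|i j m]; last exact: singletons_convex Hw.
  apply: eq_count => i; rewrite /S /Q.
  case: singleton_at; case: singleton_at; rewrite ?andbF //=.
  by lia.
rewrite count_sumn; apply: eq_count => i.
have Hle := faro_le2 Hw.
rewrite /Q /pattern_at; case Hi: (i.+1 < size w); last first.
  by rewrite /singleton_at Hi andbF.
case: eqP => [E|]; rewrite ?andbF //.
have -> : 0 < nth 0 w i < 1 + k by have := kary_nth Hk (ltnW Hi); lia.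
have pF : pair_at w i = false by rewrite /pair_at /pattern_at E ltnn andbF.
rewrite /singleton_at pF Hi (ltnW Hi) /= ?pF ?andbT; apply/esym/andP; split.
  case: i Hi E pF => //= i Hi E _; apply/negP => /andP [_].
  by have := Hle i Hi; lia.
by apply/negP => /andP [h]; have := Hle i h; lia.
Qed.

Lemma occ_total w : occ11 w + occ12 w + occ21 w = (size w).-1.
Proof.
have -> : occ11 w + occ12 w + occ21 w =
    count (fun i => i.+1 < size w) (iota 0 (size w)).
  rewrite /occ11 /occ12 /occ21 /pattern_occ; elim: (iota _ _) => //= i s <-.
  by rewrite /pattern_at; case: (_ < size w) => //=; lia.
case: (size w) => // m; rewrite -addn1 iotaD count_cat /= add0n addn1 ltnn.
rewrite addn0 (@eq_in_count _ _ predT) ?count_predT ?size_iota ?addn0 // => i.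
by rewrite mem_iota add0n ltnS.
Qed.

Theorem theorem2p8 (n k : nat) (hk : 0 < k) (w : faro_word n k) :
  let P := faro_map w in
  [/\ occ11 w = factor_occ [:: F; F] P,
      occ21 w = factor_occ [:: U; U] P /\
      factor_occ [:: U; U] P = factor_occ [:: D; D] P,
      occ12 w = star_occ [:: D; D] [:: U; D] [:: U; U] P
              + star_occ [:: D; D] [:: U; D] [:: D] P
              + star_occ [:: D; D] [:: U; D] [:: F] P
              + plus_occ [:: F] [:: U; D] [:: F] P
              + star_occ [:: F] [:: U; D] [:: U; U] P
    & 0 < n ->
      ((occ12 w)%:Z = n%:Z - 1 - (factor_occ [:: U; U] P)%:Z
                      - (factor_occ [:: F; F] P)%:Z)%R].
Proof.
move=> P; have Hw := faro_faro w.
have HP : ok 0 P by exact: ok_faro_steps Hw.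
have EDD := dyck_UU_DD HP.
have Esize : n = count_mem F P + (factor_occ [:: U; U] P).*2.
  have := dyck_size HP; rewrite (disp_size P) (disp_peaks P); lia.
have E11 : occ11 w = factor_occ [:: F; F] P.
  rewrite (occ11_singletons Hw) /= /P /=.
  by case: k hk w P Hw {HP EDD Esize} => // k _ w _ _; rewrite FF_faro_steps.
have E21 : occ21 w = factor_occ [:: U; U] P.
  rewrite /P /=.
  by case: k hk w P Hw {HP EDD Esize E11} => // k _ w _ Hw; rewrite UU_faro_steps.
have Etot := occ_total w; rewrite faro_size in Etot.
have Erun := run_patterns HP.
split=> //; lia.
Qed.
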